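(* Let $\alpha\in\mathbb T\setminus\{1\}$. For $r\in[0,\infty)\setminus\{1\}$ define $T_r:L^2(\mu)\to L^2(\mu_\alpha)$ by $$T_rf(z)=\int_{\mathbb T}\frac{f(\xi)\,d\mu(\xi)}{1-r\overline\xi z}.$$ Then $\sup_{r\in[0,\infty)\setminus\{1\}}\|T_r\|_{L^2(\mu)\to L^2(\mu_\alpha)}<\infty$.
   Context: $\mathbb T=\{|z|=1\}$. Let $\mu$ be a Borel probability measure on $\mathbb T$, $U=M_\xi$ multiplication by the independent variable on $L^2(\mu)$. For $\alpha\in\mathbb T$, $U_\alpha$ is the unitary operator $(U_\alpha f)(\xi)=\xi f(\xi)+(\alpha-1)\int_{\mathbb T}f(\zeta)\zeta\,d\mu(\zeta)$ on $L^2(\mu)$ (a rank one perturbation of $U$ with $*$-cyclic vector $\mathbf 1$), and $\mu_\alpha$ is its spectral measure with respect to $\mathbf 1$, i.e. the probability measure with $\int z^nd\mu_\alpha(z)=(U_\alpha^n\mathbf 1,\mathbf 1)_{L^2(\mu)}$ for all $n\in\mathbb Z$. *)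

(* Defs.v *)
(* MathComp-Analysis (measure theory, integration) over an
   abstract R : realType, complex numbers R[i] from mathcomp-real-closed. *)
From HB Require Import structures.
From mathcomp Require Import all_boot all_order all_algebra.
From mathcomp Require Import all_classical all_reals all_analysis.
From mathcomp Require Import complex.
Set Implicit Arguments. Unset Strict Implicit. Unset Printing Implicit Defensive.
Import Order.TTheory GRing.Theory Num.Theory.
Local Open Scope ring_scope.
Local Open Scope complex_scope.

Section Defs.
Variable R : realType.

(* Points of the plane R x R, identified with complex numbers x + i y.
   The unit circle T is the set of points with x^2 + y^2 = 1. *)
Definition toC (p : R * R) : R[i] := (p.1 +i* p.2)%C.

Definition circle : set (R * R) := [set p | p.1 ^+ 2 + p.2 ^+ 2 = 1].

(* squared modulus of a complex number *)
Definition cabs2 (z : R[i]) : R := (complex.Re z) ^+ 2 + (complex.Im z) ^+ 2.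

(* integral of a complex valued function: integral of real part + i * integral
   of imaginary part *)
Definition cint (mu : {measure set (R * R)%type -> \bar R})
  (f : R * R -> R[i]) : R[i] :=
  ((\int[mu]_x complex.Re (f x)) +i* (\int[mu]_x complex.Im (f x)))%C.

(* measurability of a complex valued function (real and imaginary parts) *)
Definition cmeasurable (f : R * R -> R[i]) : Prop :=
  measurable_fun setT (fun x => complex.Re (f x)) /\
  measurable_fun setT (fun x => complex.Im (f x)).

Variable mu : probability (R * R)%type R.
Variable alpha : R[i].

(* U_alpha f (xi) = xi f(xi) + (alpha - 1) * \int f(zeta) zeta dmu(zeta) *)
Definition Ualpha (f : R * R -> R[i]) : R * R -> R[i] :=
  fun xi => toC xi * f xi + (alpha - 1) * cint mu (fun zeta => f zeta * toC zeta).

(* the inverse ( = adjoint) of the unitary operator U_alpha: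
   U_alpha^{-1} g (xi) = conj(xi) g(xi) + (conj(alpha) - 1) conj(xi) \int g dmu *)
Definition Ualpha_inv (g : R * R -> R[i]) : R * R -> R[i] :=
  fun xi => (toC xi)^* * g xi + ((alpha^*)%C - 1) * (toC xi)^* * cint mu g.

(* integer powers U_alpha^n *)
Definition Ualpha_pow (n : int) : (R * R -> R[i]) -> (R * R -> R[i]) :=
  match n with
  | Posz k => iter k Ualpha
  | Negz k => iter k.+1 Ualpha_inv
  end.

(* T_r f (z) = \int f(xi) / (1 - r conj(xi) z) dmu(xi) *)
Definition Tr (r : R) (f : R * R -> R[i]) : R * R -> R[i] :=
  fun z => cint mu (fun xi => f xi / (1 - r%:C * (toC xi)^* * toC z)).

End Defs.

(* Main.v *)
Require Import Defs.
From HB Require Import structures.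
From mathcomp Require Import all_boot all_order all_algebra.
From mathcomp Require Import all_classical all_reals all_analysis.
From mathcomp Require Import complex.
From mathcomp Require Import measurable_realfun ring lra.
Import Order.TTheory GRing.Theory Num.Theory.
Local Open Scope ring_scope.

(** Write [A = U_alpha], [c = alpha - 1], and let [a_k] be the integral of
    [conj(xi)^k f] against [mu].  Since [A (conj(xi) h) - h] is the constant
    [c * \int h dmu], telescoping [A^n (conj(xi)^n f) - f] yields
    [c * \sum_(k < n) a_k A^k 1 = A^n (conj(xi)^n f) - f], whose squared norm
    is at most [4 |f|^2] because [A] is isometric.  The moments of [mu_alpha]
    say that [z^k] in [L^2(mu_alpha)] and [A^k 1] in [L^2(mu)] have the same
    Gram matrix, so the partial sums of [\sum_k a_k z^k] are bounded in
    [L^2(mu_alpha)] uniformly in [n]; hence so are their Abel means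
    [\sum_(k < n) r^k a_k z^k], which lie in the convex hull of the partial
    sums.  For [r < 1] these differ from [T_r f] on the circle by at most [|f|]
    once [r^n <= 1 - r].  For [r > 1], on the circle
    [T_r f = \int f dmu - conj (T_(1/r) (conj f))]. *)

(** * Algebra and inequalities for the squared modulus *)

Section SquaredModulus.
Context {R : realType}.
Implicit Types (x y : R[i]) (r : R).

Lemma complex_ext x y : complex.Re x = complex.Re y ->
  complex.Im x = complex.Im y -> x = y.
Proof. by case: x y => [a b] [c d] /= -> ->. Qed.

Lemma RecD x y : complex.Re (x + y) = complex.Re x + complex.Re y.
Proof. by case: x y => [a b] [c d]. Qed.

Lemma ImcD x y : complex.Im (x + y) = complex.Im x + complex.Im y.
Proof. by case: x y => [a b] [c d]. Qed.

Lemma RecM x y : complex.Re (x * y) =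
  complex.Re x * complex.Re y - complex.Im x * complex.Im y.
Proof. by case: x y => [a b] [c d]. Qed.

Lemma ImcM x y : complex.Im (x * y) =
  complex.Re x * complex.Im y + complex.Im x * complex.Re y.
Proof. by case: x y => [a b] [c d]. Qed.

Lemma Re_conjc x : complex.Re (conjc x) = complex.Re x.
Proof. by case: x. Qed.

Lemma Im_conjc x : complex.Im (conjc x) = - complex.Im x.
Proof. by case: x. Qed.

Lemma cabs2_ge0 x : 0 <= cabs2 x.
Proof. by rewrite addr_ge0 ?sqr_ge0. Qed.

Lemma cabs2M x y : cabs2 (x * y) = cabs2 x * cabs2 y.
Proof. by rewrite /cabs2 RecM ImcM; ring. Qed.

Lemma cabs2X x n : cabs2 (x ^+ n) = cabs2 x ^+ n.
Proof.
elim: n => [|n IHn]; first by rewrite !expr0 /cabs2 /= expr1n expr0n addr0.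
by rewrite !exprS cabs2M IHn.
Qed.

Lemma cabs2N x : cabs2 (- x) = cabs2 x.
Proof. by case: x => a b; rewrite /cabs2 /= !sqrrN. Qed.

Lemma cabs2_conjc x : cabs2 (conjc x) = cabs2 x.
Proof. by rewrite /cabs2 Re_conjc Im_conjc sqrrN. Qed.

Lemma cabs2_real r : cabs2 (real_complex R r) = r ^+ 2.
Proof. by rewrite /cabs2 /= expr0n addr0. Qed.

Lemma conjcD x y : conjc (x + y) = conjc x + conjc y.
Proof. exact: rmorphD. Qed.

Lemma conjcN x : conjc (- x) = - conjc x.
Proof. exact: rmorphN. Qed.

Lemma conjcM x y : conjc (x * y) = conjc x * conjc y.
Proof. exact: rmorphM. Qed.

Lemma mulc_conjc x : x * conjc x = real_complex R (cabs2 x).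
Proof.
by apply: complex_ext; rewrite ?RecM ?ImcM Re_conjc Im_conjc /cabs2 /=; ring.
Qed.

Lemma cabs2_eq0 x : (cabs2 x == 0) = (x == 0).
Proof.
by case: x => a b; rewrite eq_complex /cabs2 /= paddr_eq0 ?sqr_ge0// !sqrf_eq0.
Qed.

(** The gap between the two sides is [|x - y|^2]. *)
Lemma cabs2D_le x y : cabs2 (x + y) <= 2 * cabs2 x + 2 * cabs2 y.
Proof.
rewrite /cabs2 RecD ImcD; move: (complex.Re x) (complex.Im x) => a b.
move: (complex.Re y) (complex.Im y) => c d.
have := sqr_ge0 (a - c); have := sqr_ge0 (b - d); nra.
Qed.

(** The two sides differ by [r (1 - r) |x - y|^2]. This convexity makes a ball of L^2 stable under
    the averaging that produces Abel means. *)
Lemma cabs2_convex r x y : 0 <= r <= 1 ->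
  cabs2 (real_complex R (1 - r) * x + real_complex R r * y)
  <= (1 - r) * cabs2 x + r * cabs2 y.
Proof.
move=> /andP[r0 r1]; rewrite /cabs2 RecD ImcD !RecM !ImcM /= !mul0r !subr0 !addr0.
rewrite -subr_ge0; set D := (X in 0 <= X).
have -> : D = r * (1 - r) * ((complex.Re x - complex.Re y) ^+ 2 +
  (complex.Im x - complex.Im y) ^+ 2) by rewrite /D; ring.
by rewrite !mulr_ge0 ?subr_ge0 ?addr_ge0 ?sqr_ge0.
Qed.

Lemma cabs2V x : cabs2 x^-1 = (cabs2 x)^-1.
Proof.
have [->|x0] := eqVneq x 0.
  by rewrite invr0 /cabs2 /= expr0n addr0 invr0.
have c0 : cabs2 x != 0 by rewrite cabs2_eq0.
by apply: (mulfI c0); rewrite -cabs2M !mulfV// cabs2_real expr1n.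
Qed.

End SquaredModulus.

(** * Measurability of complex-valued functions *)

Section ComplexMeasurable.
Context {R : realType}.
Implicit Types f g : R * R -> R[i].

Lemma cmeasurable_cst (a : R[i]) : cmeasurable (fun=> a).
Proof. by split; exact: measurable_cst. Qed.

Lemma cmeasurableD f g : cmeasurable f -> cmeasurable g ->
  cmeasurable (fun x => f x + g x).
Proof.
move=> [f1 f2] [g1 g2]; split.
- by under eq_fun do rewrite RecD; exact: measurable_funD.
- by under eq_fun do rewrite ImcD; exact: measurable_funD.
Qed.

Lemma cmeasurableM f g : cmeasurable f -> cmeasurable g ->
  cmeasurable (fun x => f x * g x).
Proof.
move=> [f1 f2] [g1 g2]; split.
- by under eq_fun do rewrite RecM; apply: measurable_funB; exact: measurable_funM.
- by under eq_fun do rewrite ImcM; apply: measurable_funD; exact: measurable_funM.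
Qed.

Lemma cmeasurable_conjc f : cmeasurable f -> cmeasurable (fun x => conjc (f x)).
Proof.
move=> [f1 f2]; split.
- by under eq_fun do rewrite Re_conjc.
- by under eq_fun do rewrite Im_conjc; exact: measurableT_comp.
Qed.

Lemma cmeasurableX f n : cmeasurable f -> cmeasurable (fun x => f x ^+ n).
Proof.
move=> mf; elim: n => [|n IHn].
  by under eq_fun do rewrite expr0; exact: cmeasurable_cst.
by under eq_fun do rewrite exprS; exact: cmeasurableM.
Qed.

Lemma cmeasurable_toC : cmeasurable (@toC R).
Proof. by split => /=; [exact: measurable_fst|exact: measurable_snd]. Qed.

Lemma measurable_cabs2 f : cmeasurable f ->
  measurable_fun setT (fun x => cabs2 (f x)).
Proof.
by move=> [f1 f2]; apply: measurable_funD; apply: measurable_funX.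
Qed.

Lemma cmeasurableV f : cmeasurable f -> cmeasurable (fun x => (f x)^-1).
Proof.
move=> mf.
have mV : measurable_fun setT (fun x => (cabs2 (f x))^-1).
  under eq_fun do rewrite -powR_inv1 ?cabs2_ge0//.
  by apply: (measurableT_comp (measurable_powR _)); exact: measurable_cabs2.
(* The formula [1 / w = conj w / |w|^2] also holds at [w = 0], where both sides are 0 because the
   inverse of 0 is 0. *)
have -> : (fun x => (f x)^-1) =
    (fun x => real_complex R (cabs2 (f x))^-1 * conjc (f x)).
  apply/funext => x; have [->|fx0] := eqVneq (f x) 0.
    by rewrite invr0 conjc0 mulr0.
  apply: (mulfI fx0); rewrite mulfV// mulrCA mulc_conjc.
  by rewrite fmorphV/= mulVf// fmorph_eq0 cabs2_eq0.
apply: cmeasurableM; last exact: cmeasurable_conjc.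
by split => //=; exact: measurable_cst.
Qed.

Lemma measurable_circle : measurable (@circle R).
Proof.
have -> : @circle R = ((fun x => cabs2 (toC x)) @^-1` [set 1])%classic.
  by apply/seteqP; split.
rewrite -[X in measurable X]setTI.
by apply: (measurable_cabs2 _ cmeasurable_toC) => //; exact: measurable_set1.
Qed.

End ComplexMeasurable.

(** * Integration and L^2 estimates on the circle *)

Section CircleIntegral.
Context {R : realType} (nu : probability (R * R)%type R).
Implicit Types (f g u : R * R -> R[i]) (a : R[i]).

(** Restricting to the circle lets identities such as [z * conj z = 1], which fail off it, be used
    under the integral. *)
Definition circle_int f : R[i] :=
  Complex (\int[nu]_(x in @circle R) complex.Re (f x))
          (\int[nu]_(x in @circle R) complex.Im (f x)).

(** The real-valued integral sends an infinite value to 0, so this is the squared L^2 norm only for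
    square integrable [f]. *)
Definition normsq f : R := \int[nu]_(x in @circle R) cabs2 (f x).

Definition integrableC f : Prop :=
  [/\ cmeasurable f,
      nu.-integrable (@circle R) (EFin \o (fun x => complex.Re (f x))) &
      nu.-integrable (@circle R) (EFin \o (fun x => complex.Im (f x)))].

Definition square_integrable f : Prop :=
  cmeasurable f /\ nu.-integrable (@circle R) (EFin \o (fun x => cabs2 (f x))).

Let mcircle := @measurable_circle R.

Lemma integrable_le (g h : R * R -> R) : measurable_fun setT g ->
  nu.-integrable (@circle R) (EFin \o h) ->
  (forall x, circle x -> `|g x| <= h x) -> nu.-integrable (@circle R) (EFin \o g).
Proof.
move=> mg ih gh; apply: le_integrable ih => //.
  by apply/measurable_EFinP; exact: measurable_funTS.
by move=> x /gh gx; rewrite /= lee_fin (le_trans gx)// ler_norm.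
Qed.

Lemma integrable_lin (r s : R) (g h : R * R -> R) :
  nu.-integrable (@circle R) (EFin \o g) ->
  nu.-integrable (@circle R) (EFin \o h) ->
  nu.-integrable (@circle R) (EFin \o (fun x => r * g x + s * h x)).
Proof.
move=> ig ih.
rewrite (_ : _ \o _ = (fun x => r%:E * (EFin \o g) x)%E \+
  (fun x => s%:E * (EFin \o h) x)%E); last exact/funext.
by apply: integrableD => //; exact: integrableZl.
Qed.

Lemma Rintegral_lin (r s : R) (g h : R * R -> R) :
  nu.-integrable (@circle R) (EFin \o g) ->
  nu.-integrable (@circle R) (EFin \o h) ->
  \int[nu]_(x in @circle R) (r * g x + s * h x) =
  r * (\int[nu]_(x in @circle R) g x) + s * (\int[nu]_(x in @circle R) h x).
Proof.
move=> ig ih; rewrite RintegralD ?RintegralZl//.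
- exact: (@integrableZl _ _ _ nu _ mcircle r _ ig).
- exact: (@integrableZl _ _ _ nu _ mcircle s _ ih).
Qed.

Lemma integrableC_lin a f g : integrableC f -> integrableC g ->
  integrableC (fun x => f x + a * g x).
Proof.
move=> [mf f1 f2] [mg g1 g2]; split.
- by apply: cmeasurableD => //; apply: cmeasurableM => //; exact: cmeasurable_cst.
- rewrite (_ : (fun x => _) = (fun x => 1 * complex.Re (f x) +
    1 * (complex.Re a * complex.Re (g x) + - complex.Im a * complex.Im (g x)))).
    by do 2?apply: integrable_lin.
  by apply/funext => x; rewrite RecD RecM; ring.
- rewrite (_ : (fun x => _) = (fun x => 1 * complex.Im (f x) +
    1 * (complex.Re a * complex.Im (g x) + complex.Im a * complex.Re (g x)))).
    by do 2?apply: integrable_lin.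
  by apply/funext => x; rewrite ImcD ImcM; ring.
Qed.

Lemma circle_int_lin a f g : integrableC f -> integrableC g ->
  circle_int (fun x => f x + a * g x) = circle_int f + a * circle_int g.
Proof.
move=> [mf f1 f2] [mg g1 g2]; apply: complex_ext => /=.
- rewrite RecD RecM /=.
  under eq_Rintegral do rewrite RecD RecM -mulNr -[complex.Re (f _)]mul1r
    -[X in _ + X]mul1r.
  by rewrite !Rintegral_lin ?mul1r ?mulNr//; exact: integrable_lin.
- rewrite ImcD ImcM /=.
  under eq_Rintegral do rewrite ImcD ImcM -[complex.Im (f _)]mul1r
    -[X in _ + X]mul1r.
  by rewrite !Rintegral_lin ?mul1r//; exact: integrable_lin.
Qed.

Lemma eq_circle_int f g : (forall x, circle x -> f x = g x) ->
  circle_int f = circle_int g.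
Proof.
move=> fg; congr Complex; apply: eq_Rintegral => x /set_mem/fg -> //.
Qed.

Lemma circle_int_conjc f : integrableC f ->
  circle_int (fun x => conjc (f x)) = conjc (circle_int f).
Proof.
move=> [mf f1 f2]; apply: complex_ext; rewrite ?Re_conjc ?Im_conjc /=.
  by under eq_Rintegral do rewrite Re_conjc.
under eq_Rintegral do rewrite Im_conjc -mulN1r.
by rewrite RintegralZl// mulN1r.
Qed.

Lemma square_integrable_lin a f g : square_integrable f -> square_integrable g ->
  square_integrable (fun x => f x + a * g x).
Proof.
move=> [mf f2] [mg g2].
have m : cmeasurable (fun x => f x + a * g x).
  by apply: cmeasurableD => //; apply: cmeasurableM => //; exact: cmeasurable_cst.
split=> //.
apply: (integrable_le _ _ (measurable_cabs2 _ m)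
  (integrable_lin 2 (2 * cabs2 a) _ _ f2 g2)) => x _.
by rewrite ger0_norm ?cabs2_ge0// -mulrA -cabs2M; exact: cabs2D_le.
Qed.

(** Here [u] plays the role of a power of [z] or of a Cauchy kernel, whose bound is available only
    on the circle. *)
Lemma square_integrableM u f (M : R) : cmeasurable u ->
  (forall x, circle x -> cabs2 (u x) <= M) -> square_integrable f ->
  square_integrable (fun x => f x * u x).
Proof.
move=> mu uM [mf f2].
have m : cmeasurable (fun x => f x * u x) by exact: cmeasurableM.
split=> //.
apply: (integrable_le _ _ (measurable_cabs2 _ m)
  (integrable_lin M 0 _ _ f2 f2)) => x cx.
rewrite mul0r addr0 ger0_norm ?cabs2_ge0// cabs2M mulrC.
by rewrite ler_wpM2r ?cabs2_ge0 ?uM.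
Qed.

Lemma normsqM_le u f (M : R) : cmeasurable u ->
  (forall x, circle x -> cabs2 (u x) <= M) -> square_integrable f ->
  normsq (fun x => f x * u x) <= M * normsq f.
Proof.
move=> mu uM f2; rewrite -RintegralZl//; last by case: f2.
apply: le_Rintegral => //.
- by have [] := square_integrableM _ _ M mu uM f2.
- have [_ g2] := f2.
  rewrite (_ : (fun x => _) = (fun x => M * cabs2 (f x) + 0 * cabs2 (f x))).
    exact: integrable_lin.
  by apply/funext => x; rewrite mul0r addr0.
- by move=> x cx; rewrite cabs2M mulrC ler_wpM2r ?cabs2_ge0 ?uM.
Qed.

Lemma square_integrable_cst a : square_integrable (fun=> a).
Proof.
split; first exact: cmeasurable_cst.
by apply: finite_measure_integrable_cst.
Qed.

Lemma integrableC_mul f g : square_integrable f -> square_integrable g ->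
  integrableC (fun x => f x * g x).
Proof.
move=> [mf f2] [mg g2].
have m : cmeasurable (fun x => f x * g x) by exact: cmeasurableM.
have [m1 m2] := m.
split => //; [apply: (integrable_le _ _ m1 (integrable_lin 1 1 _ _ f2 g2))
             |apply: (integrable_le _ _ m2 (integrable_lin 1 1 _ _ f2 g2))] => x _.
- rewrite RecM /cabs2; move: (complex.Re (f x)) (complex.Im (f x)) => a b.
  move: (complex.Re (g x)) (complex.Im (g x)) => c d.
  (* Expanding these squares bounds [|a c - b d|] by the sum of the four squares. *)
  have := sqr_ge0 (a - c); have := sqr_ge0 (b - d).
  have := sqr_ge0 (a + c); have := sqr_ge0 (b + d).
  by move=> h1 h2 h3 h4; rewrite ler_norml; apply/andP; split; nra.
- rewrite ImcM /cabs2; move: (complex.Re (f x)) (complex.Im (f x)) => a b.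
  move: (complex.Re (g x)) (complex.Im (g x)) => c d.
  have := sqr_ge0 (a - d); have := sqr_ge0 (b - c).
  have := sqr_ge0 (a + d); have := sqr_ge0 (b + c).
  by move=> h1 h2 h3 h4; rewrite ler_norml; apply/andP; split; nra.
Qed.

(** L^2 lies in L^1 for a finite measure: [f] is multiplied by the square integrable constant 1. *)
Lemma square_integrableC f : square_integrable f -> integrableC f.
Proof.
move=> f2; have := integrableC_mul _ _ f2 (square_integrable_cst 1).
by under eq_fun do rewrite mulr1.
Qed.

Lemma square_integrable_conjc f : square_integrable f ->
  square_integrable (fun x => conjc (f x)).
Proof.
move=> [mf f2]; split; first exact: cmeasurable_conjc.
by rewrite (_ : (fun x => _) = (fun x => cabs2 (f x)))//;
  apply/funext => x; rewrite cabs2_conjc.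
Qed.

Lemma normsq_conjc f : normsq (fun x => conjc (f x)) = normsq f.
Proof. by apply: eq_Rintegral => x _; rewrite cabs2_conjc. Qed.

Lemma integrableC_sum n (F : nat -> R * R -> R[i]) :
  (forall k, integrableC (F k)) -> integrableC (fun x => \sum_(k < n) F k x).
Proof.
move=> iF; elim: n => [|n IHn].
  under eq_fun do rewrite big_ord0.
  exact/square_integrableC/square_integrable_cst.
under eq_fun do rewrite big_ord_recr/= -[X in _ + X]mul1r.
exact: integrableC_lin.
Qed.

Lemma circle_int_sum n (F : nat -> R * R -> R[i]) :
  (forall k, integrableC (F k)) ->
  circle_int (fun x => \sum_(k < n) F k x) = \sum_(k < n) circle_int (F k).
Proof.
move=> iF; elim: n => [|n IHn].
  rewrite big_ord0; under eq_fun do rewrite big_ord0.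
  by apply: complex_ext; rewrite /= /Rintegral integral0_eq.
rewrite big_ord_recr/= -IHn -[X in _ + X]mul1r -circle_int_lin//.
  by apply: eq_circle_int => x _; rewrite big_ord_recr/= mul1r.
exact: integrableC_sum.
Qed.

Lemma square_integrable_sum n (F : nat -> R * R -> R[i]) :
  (forall k, square_integrable (F k)) ->
  square_integrable (fun x => \sum_(k < n) F k x).
Proof.
move=> iF; elim: n => [|n IHn].
  by under eq_fun do rewrite big_ord0; exact: square_integrable_cst.
under eq_fun do rewrite big_ord_recr/= -[X in _ + X]mul1r.
exact: square_integrable_lin.
Qed.

Lemma circle_intZ a f : integrableC f ->
  circle_int (fun x => a * f x) = a * circle_int f.
Proof.
move=> fi.
(* Scaling is the case of a zero first summand in [f + a * g]. *)
have i0 : integrableC (fun=> 0) by exact/square_integrableC/square_integrable_cst.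
have := circle_int_lin a (fun=> 0) f i0 fi.
under eq_fun do rewrite add0r; move=> ->.
by rewrite (_ : circle_int _ = 0) ?add0r//;
  apply: complex_ext; rewrite /= /Rintegral integral0_eq.
Qed.

(** This turns norms into inner products, which can be expanded by linearity in [R[i]]. *)
Lemma normsq_circle_int f : real_complex R (normsq f) =
  circle_int (fun x => f x * conjc (f x)).
Proof.
apply: complex_ext => /=.
  by apply: eq_Rintegral => x _; rewrite mulc_conjc.
by under eq_Rintegral do rewrite mulc_conjc/=; rewrite /Rintegral integral0_eq.
Qed.

Lemma normsqZ a f : square_integrable f ->
  normsq (fun x => a * f x) = cabs2 a * normsq f.
Proof.
move=> [_ f2]; rewrite /normsq -RintegralZl//.
by apply: eq_Rintegral => x _; rewrite cabs2M.
Qed.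

Lemma normsq_le_lin (r s : R) f g u :
  square_integrable f -> square_integrable g -> square_integrable u ->
  (forall x, circle x -> cabs2 (u x) <= r * cabs2 (f x) + s * cabs2 (g x)) ->
  normsq u <= r * normsq f + s * normsq g.
Proof.
move=> [_ f2] [_ g2] [_ u2] h; rewrite /normsq -Rintegral_lin//.
by apply: le_Rintegral => //; exact: integrable_lin.
Qed.

Hypothesis nu_circle : nu (~` @circle R)%classic = 0%E.

Lemma measure_circle : nu (@circle R) = 1%E.
Proof.
have := probability_setC nu mcircle.
rewrite nu_circle => /esym/eqP; rewrite sube_eq ?fin_num_measure//.
by rewrite add0e => /eqP <-.
Qed.

Lemma circle_int_cst a : circle_int (fun=> a) = a.
Proof.
have m1 : fine (nu (@circle R)) = 1 by rewrite measure_circle.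
by apply: complex_ext => /=; rewrite Rintegral_cst// [fine _]m1 mulr1.
Qed.

Lemma normsq_cst a : normsq (fun=> a) = cabs2 a.
Proof.
have m1 : fine (nu (@circle R)) = 1 by rewrite measure_circle.
by rewrite /normsq Rintegral_cst// [fine _]m1 mulr1.
Qed.

(** [h] and its extension by 0 from the circle differ only on a null set. *)
Lemma integral_circle (h : R * R -> R) : measurable_fun setT h ->
  (\int[nu]_x (h x)%:E = \int[nu]_(x in @circle R) (h x)%:E)%E.
Proof.
move=> mh; rewrite [RHS]integral_mkcond; apply: ae_eq_integral => //.
- exact/measurable_EFinP.
- apply/measurable_restrict => //; rewrite setTI.
  by apply/measurable_EFinP; exact: measurable_funTS.
- exists (~` @circle R)%classic; split => //; first exact: measurableC.
  move=> x /= h1 cx; apply: h1 => _.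
  by rewrite patchE mem_set.
Qed.

Lemma cint_circle_int f : cmeasurable f -> cint nu f = circle_int f.
Proof. by move=> [f1 f2]; congr Complex; rewrite /Rintegral integral_circle. Qed.

(* Integrate [2 Re (conj m * f) <= |f|^2 + |m|^2] for [m] the mean of [f]. *)
Lemma cabs2_circle_int_le f : square_integrable f ->
  cabs2 (circle_int f) <= normsq f.
Proof.
move=> f2; set m := circle_int f.
have fi := square_integrableC _ f2.
have mfi : integrableC (fun x => conjc m * f x).
  have i0 := square_integrableC _ (square_integrable_cst 0).
  by have := integrableC_lin (conjc m) _ _ i0 fi; under eq_fun do rewrite add0r.
have : 2 * \int[nu]_(x in @circle R) complex.Re (conjc m * f x) <=
    1 * normsq f + 1 * normsq (fun=> m).
  have [_ g2] := square_integrable_cst m.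
  rewrite /normsq -Rintegral_lin ?(proj2 f2)// -RintegralZl//; last by case: mfi.
  apply: le_Rintegral => //.
  - case: mfi => _ mf1 _.
    by have := integrable_lin 2 0 _ _ mf1 mf1;
      under eq_fun do rewrite mul0r addr0.
  - by apply: integrable_lin => //; case: f2.
  move=> x _; rewrite RecM Re_conjc Im_conjc /cabs2.
  move: (complex.Re m) (complex.Im m) => p q.
  move: (complex.Re (f x)) (complex.Im (f x)) => c d.
  by have := sqr_ge0 (p - c); have := sqr_ge0 (q - d); nra.
rewrite -[\int[nu]_(x in _) _]/(complex.Re (circle_int (fun x => conjc m * f x))).
rewrite circle_intZ// -/m [conjc m * m]mulrC mulc_conjc /= normsq_cst; lra.
Qed.

End CircleIntegral.

(** * Norms of linear combinations through Gram matrices *)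

Section Gram.
Context {R : realType}.

(** The squared norm of a combination is a quadratic form in the coefficients whose matrix is the
    Gram matrix of the family, so it does not depend on the space in which the family lives. *)
Lemma eq_normsq_gram (nu1 nu2 : probability (R * R)%type R)
    (F1 F2 : nat -> R * R -> R[i]) (a : nat -> R[i]) n :
  (forall k, square_integrable nu1 (F1 k)) ->
  (forall k, square_integrable nu2 (F2 k)) ->
  (forall j k, circle_int nu1 (fun x => F1 j x * conjc (F1 k x)) =
               circle_int nu2 (fun x => F2 j x * conjc (F2 k x))) ->
  normsq nu1 (fun x => \sum_(k < n) a k * F1 k x) =
  normsq nu2 (fun x => \sum_(k < n) a k * F2 k x).
Proof.
have gram nu (F : nat -> _) : (forall k, square_integrable nu (F k)) ->
    real_complex R (normsq nu (fun x => \sum_(k < n) a k * F k x)) =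
    \sum_(j < n) \sum_(k < n) a j * conjc (a k) *
      circle_int nu (fun x => F j x * conjc (F k x)).
  move=> sF.
  pose G j k x := a j * conjc (a k) * (F j x * conjc (F k x)).
  have iF j k : integrableC nu (fun x => F j x * conjc (F k x)).
    by apply: integrableC_mul => //; exact: square_integrable_conjc.
  have iG j k : integrableC nu (G j k).
    have i0 := square_integrableC nu _ (square_integrable_cst nu 0).
    have := integrableC_lin nu (a j * conjc (a k)) _ _ i0 (iF j k).
    by under eq_fun do rewrite add0r.
  have iS j : integrableC nu (fun x => \sum_(k < n) G j k x).
    exact: integrableC_sum.
  rewrite normsq_circle_int.
  transitivity (circle_int nu (fun x => \sum_(j < n) \sum_(k < n) G j k x)).
    apply: eq_circle_int => x _; rewrite rmorph_sum/= big_distrlr/=.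
    by apply: eq_bigr => j _; apply: eq_bigr => k _; rewrite rmorphM/= /G; ring.
  rewrite (circle_int_sum nu n (fun j x => \sum_(k < n) G j k x))//.
  apply: eq_bigr => j _.
  rewrite (circle_int_sum nu n (fun k x => G j k x))//; apply: eq_bigr => k _.
  exact: circle_intZ.
move=> F12 F22 F1F2; apply: (@complexI R).
rewrite !gram//; apply: eq_bigr => j _; apply: eq_bigr => k _.
by rewrite F1F2.
Qed.

End Gram.

(** * Multiplication by [z] and by powers of [conj z] on the circle *)

Section CircleMultiplier.
Context {R : realType} (nu : probability (R * R)%type R).
Implicit Types f : R * R -> R[i].

Lemma cabs2_toC (x : R * R) : circle x -> cabs2 (toC x) = 1.
Proof. by []. Qed.

Lemma toC_conjc (x : R * R) : circle x -> toC x * conjc (toC x) = 1.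
Proof. by move=> cx; rewrite mulc_conjc cabs2_toC. Qed.

Lemma square_integrable_toC f : square_integrable nu f ->
  square_integrable nu (fun x => f x * toC x).
Proof.
move=> f2; apply: (square_integrableM nu _ _ 1 cmeasurable_toC) => // x cx.
by rewrite cabs2_toC.
Qed.

Lemma square_integrable_toC_conjcX f n : square_integrable nu f ->
  square_integrable nu (fun x => f x * conjc (toC x) ^+ n).
Proof.
have m := cmeasurableX _ n (cmeasurable_conjc _ (@cmeasurable_toC R)).
move=> f2; apply: (square_integrableM nu _ _ 1 m) => // x cx.
by rewrite cabs2X cabs2_conjc cabs2_toC// expr1n.
Qed.

End CircleMultiplier.

(** * The rank one perturbation: telescoping and isometry *)

Section Perturbation.
Context {R : realType} (mu : probability (R * R)%type R) (alpha : R[i]).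
Hypothesis mu_circle : mu (~` @circle R)%classic = 0%E.
Implicit Types (f g : R * R -> R[i]) (a : R[i]).
Local Notation A := (Ualpha mu alpha).
Local Notation L2 := (square_integrable mu).

(** The trailing factor 1 gives the shape [f + a * g] to which the linearity lemmas apply. *)
Lemma UalphaE f : L2 f -> A f = fun x => f x * toC x +
  ((alpha - 1) * circle_int mu (fun z => f z * toC z)) * 1.
Proof.
move=> f2; apply/funext => x; rewrite /Ualpha cint_circle_int//; first by ring.
by case: (square_integrable_toC _ _ f2).
Qed.

Lemma square_integrable_Ualpha f : L2 f -> L2 (A f).
Proof.
move=> f2; rewrite UalphaE//; apply: square_integrable_lin.
  exact: square_integrable_toC.
exact: square_integrable_cst.
Qed.

Lemma Ualpha_lin a f g : L2 f -> L2 g ->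
  A (fun x => f x + a * g x) = fun x => A f x + a * A g x.
Proof.
move=> f2 g2; have fg2 := square_integrable_lin _ a _ _ f2 g2.
rewrite !UalphaE//.
have -> : circle_int mu (fun z => (f z + a * g z) * toC z) =
    circle_int mu (fun z => f z * toC z) + a * circle_int mu (fun z => g z * toC z).
  rewrite -circle_int_lin; try exact/square_integrableC/square_integrable_toC.
  by apply: eq_circle_int => x _; ring.
by apply/funext => x; ring.
Qed.

(** Simplifications by [z * conj z = 1] hold only on the circle; this lets them be made inside
    [A]. *)
Lemma eq_Ualpha f g : L2 f -> L2 g -> (forall x, circle x -> f x = g x) ->
  forall x, circle x -> A f x = A g x.
Proof.
move=> f2 g2 fg x cx; rewrite !UalphaE// fg//; congr (_ + _ * _ * _).
by apply: eq_circle_int => z cz; rewrite fg.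
Qed.

Lemma square_integrable_iter_Ualpha n f : L2 f -> L2 (iter n A f).
Proof. by move=> f2; elim: n => //= n; exact: square_integrable_Ualpha. Qed.

Lemma iter_Ualpha_lin n a f g : L2 f -> L2 g ->
  iter n A (fun x => f x + a * g x) = fun x => iter n A f x + a * iter n A g x.
Proof.
move=> f2 g2; elim: n => //= n ->.
by apply: Ualpha_lin; exact: square_integrable_iter_Ualpha.
Qed.

Lemma eq_iter_Ualpha n f g : L2 f -> L2 g -> (forall x, circle x -> f x = g x) ->
  forall x, circle x -> iter n A f x = iter n A g x.
Proof.
move=> f2 g2 fg; elim: n => //= n IHn.
by apply: eq_Ualpha => //; exact: square_integrable_iter_Ualpha.
Qed.

(* A telescoping sum: on the circle [A (conj z h) = h + (alpha - 1) \int h],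
   so each factor [A * conj z] contributes one term. *)
Lemma iter_Ualpha_telescope n f : L2 f -> forall x, circle x ->
  iter n A (fun z => f z * conjc (toC z) ^+ n) x = f x + (alpha - 1) *
    \sum_(k < n) circle_int mu (fun z => f z * conjc (toC z) ^+ k) *
      iter k A (fun=> 1) x.
Proof.
move=> f2; elim: n => [|n IHn] x cx.
  by rewrite big_ord0 /= expr0 mulr1 mulr0 addr0.
set a := circle_int mu (fun z => f z * conjc (toC z) ^+ n).
have h2 := square_integrable_toC_conjcX mu f n f2.
have one2 := square_integrable_cst mu 1.
have step z : circle z -> A (fun z => f z * conjc (toC z) ^+ n.+1) z =
    f z * conjc (toC z) ^+ n + (alpha - 1) * a * 1.
  move=> cz; rewrite UalphaE//; last exact: square_integrable_toC_conjcX.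
  congr (_ + _ * _ * _).
    by rewrite exprSr -!mulrA [conjc _ * toC _]mulrC toC_conjc// mulr1.
  apply: eq_circle_int => y cy.
  by rewrite exprSr -!mulrA [conjc _ * toC _]mulrC toC_conjc// mulr1.
(* The innermost [A] is applied first. It leaves the function of the induction hypothesis plus a
   constant, and [A^n] of that constant is the new last term. *)
rewrite iterSr (eq_iter_Ualpha n _ _ _ _ step)//; first last.
- exact: square_integrable_lin.
- exact/square_integrable_Ualpha/square_integrable_toC_conjcX.
rewrite iter_Ualpha_lin// IHn// big_ord_recr/= -/a; ring.
Qed.

Hypothesis alpha_circle : cabs2 alpha = 1.

(** With [c = alpha - 1], the terms other than the inner product of [f] and [g] add up to
    [a * conj b * (c + conj c + |c|^2)], and the last factor is [|alpha|^2 - 1 = 0]. *)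
Lemma Ualpha_isometry f g : L2 f -> L2 g ->
  circle_int mu (fun x => A f x * conjc (A g x)) =
  circle_int mu (fun x => f x * conjc (g x)).
Proof.
move=> f2 g2.
have zf2 := square_integrable_toC mu _ f2.
have zg2 := square_integrable_conjc mu _ (square_integrable_toC mu _ g2).
set a := circle_int mu (fun z => f z * toC z).
set b := circle_int mu (fun z => g z * toC z).
have cb : circle_int mu (fun z => conjc (g z * toC z)) = conjc b.
  by rewrite circle_int_conjc//; exact/square_integrableC/square_integrable_toC.
pose c := alpha - 1.
have cc : c + conjc c + c * conjc c = 0.
  have : alpha * conjc alpha = 1 by rewrite mulc_conjc alpha_circle.
  move=> h; transitivity (alpha * conjc alpha - 1); last by rewrite h subrr.
  by rewrite /c rmorphB rmorph1; ring.
have i1 := integrableC_mul mu _ _ f2 (square_integrable_conjc mu _ g2).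
have i2 := square_integrableC mu _ zf2.
have i3 := square_integrableC mu _ zg2.
have i4 := square_integrableC mu _ (square_integrable_cst mu 1).
(* The four terms of the product are nested as sums [u + a * v], so that linearity can be applied
   repeatedly. *)
transitivity (circle_int mu (fun x => (f x * conjc (g x) +
    conjc (c * b) * (f x * toC x)) +
    c * a * (conjc (g x * toC x) + conjc (c * b) * 1))).
  apply: eq_circle_int => x cx; rewrite !UalphaE// -/a -/b -/c.
  rewrite !conjcD !conjcM conjc1; apply/subr0_eq.
  transitivity (f x * conjc (g x) * (toC x * conjc (toC x) - 1)); first by ring.
  by rewrite toC_conjc// subrr mulr0.
rewrite circle_int_lin; try exact: integrableC_lin.
rewrite !circle_int_lin// cb -/a circle_int_cst// conjcM.
transitivity (circle_int mu (fun x => f x * conjc (g x)) +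
  a * conjc b * (c + conjc c + c * conjc c)); first by ring.
by rewrite cc mulr0 addr0.
Qed.

Lemma iter_Ualpha_isometry n f g : L2 f -> L2 g ->
  circle_int mu (fun x => iter n A f x * conjc (iter n A g x)) =
  circle_int mu (fun x => f x * conjc (g x)).
Proof.
move=> f2 g2; elim: n => //= n IHn; rewrite -IHn.
by apply: Ualpha_isometry; exact: square_integrable_iter_Ualpha.
Qed.

Lemma normsq_iter_Ualpha n f : L2 f -> normsq mu (iter n A f) = normsq mu f.
Proof.
move=> f2; apply: (@complexI R).
by rewrite !normsq_circle_int iter_Ualpha_isometry.
Qed.

(** By telescoping, [(alpha - 1) * S] is a difference of two functions of squared norm at most
    [|f|^2]; the 4 is 2 + 2 from [cabs2D_le]. *)
Lemma normsq_partial_sum_le n f : alpha != 1 -> L2 f ->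
  normsq mu (fun x => \sum_(k < n)
    circle_int mu (fun z => f z * conjc (toC z) ^+ k) * iter k A (fun=> 1) x)
  <= 4 / cabs2 (alpha - 1) * normsq mu f.
Proof.
move=> alpha1 f2; set S := fun x => _.
have c0 : 0 < cabs2 (alpha - 1).
  by rewrite lt_def cabs2_ge0 cabs2_eq0 subr_eq0 alpha1.
have S2 : L2 S.
  apply: (square_integrable_sum mu n (fun k x =>
    circle_int mu (fun z => f z * conjc (toC z) ^+ k) * iter k A (fun=> 1) x)).
  move=> k.
  have := square_integrable_lin mu
    (circle_int mu (fun z => f z * conjc (toC z) ^+ k)) _ _ (square_integrable_cst mu 0)
    (square_integrable_iter_Ualpha k _ (square_integrable_cst mu 1)).
  by under eq_fun do rewrite add0r.
rewrite mulrAC ler_pdivlMr// mulrC -normsqZ//.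
have zf2 := square_integrable_toC_conjcX mu f n f2.
have Af2 := square_integrable_iter_Ualpha n _ zf2.
have cS2 : L2 (fun x => (alpha - 1) * S x).
  have := square_integrable_lin mu (alpha - 1) _ _ (square_integrable_cst mu 0) S2.
  by under eq_fun do rewrite add0r.
apply: (@le_trans _ _ (2 * normsq mu f + 2 *
    normsq mu (iter n A (fun z => f z * conjc (toC z) ^+ n)))).
  apply: normsq_le_lin => // x cx.
  have -> : (alpha - 1) * S x =
      - f x + iter n A (fun z => f z * conjc (toC z) ^+ n) x.
    by rewrite iter_Ualpha_telescope// addKr.
  by rewrite (le_trans (cabs2D_le _ _))// cabs2N.
rewrite normsq_iter_Ualpha//.
have : normsq mu (fun z => f z * conjc (toC z) ^+ n) <= 1 * normsq mu f.
  apply: normsqM_le => //.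
    exact/cmeasurableX/cmeasurable_conjc/cmeasurable_toC.
  by move=> x cx; rewrite cabs2X cabs2_conjc cabs2_toC// expr1n.
by lra.
Qed.

End Perturbation.

(** * Passage between integrals over the plane and over the circle *)

Import HBNNSimple.

Section NonmeasurableBound.
Context {R : realType} (nu : probability (R * R)%type R).
Hypothesis nu_circle : nu (~` @circle R)%classic = 0%E.

(* [F] may be non-measurable: its integral is a supremum over the simple
   functions below it. *)
Lemma integral_le_circle (F G : R * R -> R) : (forall x, 0 <= F x) ->
  measurable_fun setT G -> (forall x, circle x -> F x <= G x) ->
  (\int[nu]_x (F x)%:E <= \int[nu]_(x in @circle R) (G x)%:E)%E.
Proof.
move=> F0 mG FG; rewrite ge0_integralTE; last by move=> x; rewrite lee_fin.
apply: ge_ereal_sup => _ [h hF <-].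
have := integral_nnsfun nu measurableT h; rewrite patch_setT => <-.
(* The simple function [h] is measurable, so its integral may be restricted to the circle, where
   [h <= F <= G]. *)
rewrite integral_circle//.
apply: ge0_le_integral.
- exact: measurable_circle.
- by move=> x _; rewrite lee_fin.
- by apply/measurable_EFinP/measurable_funTS; exact: measurable_funPT.
- by apply/measurable_EFinP; exact: measurable_funTS.
- by move=> x cx; rewrite (le_trans (hF x))// lee_fin FG.
Qed.

Lemma square_integrable_lty (f : R * R -> R[i]) : cmeasurable f ->
  (\int[nu]_x (cabs2 (f x))%:E < +oo)%E -> square_integrable nu f.
Proof.
move=> mf foo; split=> //; apply/integrableP; split.
  apply/measurable_EFinP; apply: measurable_funTS.
  exact: measurable_cabs2.
rewrite integral_circle// in foo; last exact: measurable_cabs2.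
by under eq_integral do rewrite gee0_abs ?lee_fin ?cabs2_ge0//.
Qed.

Lemma normsq_integral (f : R * R -> R[i]) : square_integrable nu f ->
  ((normsq nu f)%:E = \int[nu]_x (cabs2 (f x))%:E)%E.
Proof.
move=> [mf f2]; rewrite integral_circle//; last exact: measurable_cabs2.
by rewrite fineK//; apply: integrable_fin_num => //; exact: measurable_circle.
Qed.

End NonmeasurableBound.

(** * Abel means as convex combinations of partial sums *)

Section AbelSum.
Context {R : realType}.
(** [K] will be a ball of L^2(mu_alpha). *)
Variable K : (R * R -> R[i]) -> Prop.
Variable r : R.
Hypothesis K_convex : forall g h, K g -> K h ->
  K (fun z => real_complex R (1 - r) * g z + real_complex R r * h z).

(* The induction peels off the first term of [p + r * \sum_k r^k x_k], which is
   [(1 - r) * p + r * ((p + x_0) + r * \sum_k r^k x_(k+1))]. *)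
Lemma abel_sum (x : nat -> R * R -> R[i]) n :
  (forall m, K (fun z => \sum_(k < m) x k z)) ->
  K (fun z => \sum_(k < n) real_complex R (r ^+ k) * x k z).
Proof.
have main : forall n (x : nat -> R * R -> R[i]) (p : R * R -> R[i]),
    (forall m, K (fun z => p z + \sum_(k < m) x k z)) ->
    K (fun z => p z + real_complex R r *
      \sum_(k < n) real_complex R (r ^+ k) * x k z).
  elim=> [|{}n IHn] {}x p Kx.
    have := Kx 0; congr K; apply/funext => z.
    by rewrite !big_ord0 mulr0.
  have Kp : K p.
    by have := Kx 0; congr K; apply/funext => z; rewrite big_ord0 addr0.
  have Kx1 m : K (fun z => (p z + x 0 z) + \sum_(k < m) x k.+1 z).
    by have := Kx m.+1; congr K; apply/funext => z; rewrite big_ord_recl addrA.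
  have := K_convex _ _ Kp (IHn (fun k => x k.+1) _ Kx1); congr K; apply/funext => z.
  rewrite big_ord_recl expr0 mul1r rmorphB rmorph1 /=.
  have -> : \sum_(k < n) real_complex R (r ^+ bump 0 k) * x (bump 0 k) z =
     real_complex R r * \sum_(k < n) real_complex R (r ^+ k) * x k.+1 z.
    by rewrite mulr_sumr; apply: eq_bigr => k _; rewrite exprS rmorphM mulrA.
  by ring.
move=> Kx; case: n => [|n].
  by have := Kx 0; congr K; apply/funext => z; rewrite !big_ord0.
(* Taking the term of index 0 as [p] and shifting the others, [main n] gives the sum of [n.+1]
   terms. *)
have Kx1 m : K (fun z => x 0 z + \sum_(k < m) x k.+1 z).
  by have := Kx m.+1; congr K; apply/funext => z; rewrite big_ord_recl.
have := main n (fun k => x k.+1) _ Kx1; congr K; apply/funext => z.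
rewrite big_ord_recl expr0 mul1r mulr_sumr; congr (_ + _).
by apply: eq_bigr => k _; rewrite exprS rmorphM mulrA.
Qed.

End AbelSum.

(** * The Cauchy kernel: geometric expansion and inversion of the radius *)

Section CauchyKernel.
Context {R : realType} (mu : probability (R * R)%type R).
Hypothesis mu_circle : mu (~` @circle R)%classic = 0%E.
Implicit Types (f : R * R -> R[i]) (r : R).

(** From [Re w <= |w| = r] one gets [|1 - w|^2 >= (1 - Re w)^2 >= (1 - r)^2]. *)
Lemma cabs2_1B_ge (w : R[i]) r : 0 <= r < 1 -> cabs2 w = r ^+ 2 ->
  (1 - r) ^+ 2 <= cabs2 (1 - w).
Proof.
move=> /andP[r0 r1]; case: w => a b; rewrite /cabs2 /= => ab.
have ar : a <= r.
  rewrite real_leNgt ?num_real//; apply/negP => ra.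
  have : r ^+ 2 < a ^+ 2 by rewrite ltr_pXn2r ?nnegrE// (le_trans r0 (ltW ra)).
  by have := sqr_ge0 b; lra.
rewrite -[leLHS]addr0 lerD ?sqr_ge0// ler_pXn2r ?nnegrE//; lra.
Qed.

Lemma cmeasurable_kernel r (z : R * R) :
  cmeasurable (fun y => (1 - real_complex R r * conjc (toC y) * toC z)^-1).
Proof.
apply: cmeasurableV; apply: cmeasurableD; first exact: cmeasurable_cst.
under eq_fun do rewrite -mulN1r.
apply: cmeasurableM; first exact: cmeasurable_cst.
apply: cmeasurableM; last exact: cmeasurable_cst.
apply: cmeasurableM; first exact: cmeasurable_cst.
exact/cmeasurable_conjc/cmeasurable_toC.
Qed.

Lemma cabs2_kernel_ge r (y z : R * R) : 0 <= r < 1 -> circle y -> circle z ->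
  (1 - r) ^+ 2 <= cabs2 (1 - real_complex R r * conjc (toC y) * toC z).
Proof.
move=> r01 cy cz; apply: cabs2_1B_ge => //.
by rewrite !cabs2M cabs2_real cabs2_conjc !cabs2_toC// !mulr1.
Qed.

(** The kernel is [\sum_(k < n) w^k + u] with [u = w^n / (1 - w)]. On the circle
    [|u| <= r^n / (1 - r) <= 1], so by Cauchy-Schwarz the remainder contributes at most [|f|]. *)
Lemma Tr_geometric f r n (z : R * R) : square_integrable mu f -> 0 <= r < 1 ->
  r ^+ n <= 1 - r -> circle z ->
  cabs2 (Tr mu r f z) <= 2 * cabs2 (\sum_(k < n) real_complex R (r ^+ k) *
    (circle_int mu (fun y => f y * conjc (toC y) ^+ k) * toC z ^+ k))
    + 2 * normsq mu f.
Proof.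
move=> f2 r01 rn cz; have /andP[r0 r1] := r01.
pose w y := real_complex R r * conjc (toC y) * toC z.
have mw : cmeasurable w.
  apply: cmeasurableM; last exact: cmeasurable_cst.
  apply: cmeasurableM; first exact: cmeasurable_cst.
  exact/cmeasurable_conjc/cmeasurable_toC.
have mV : cmeasurable (fun y => (1 - w y)^-1) by exact: cmeasurable_kernel.
have wE y : circle y -> cabs2 (w y) = r ^+ 2.
  by move=> cy; rewrite /w !cabs2M cabs2_real cabs2_conjc !cabs2_toC// !mulr1.
pose u y := w y ^+ n / (1 - w y).
have mu_ : cmeasurable u by apply: cmeasurableM => //; exact: cmeasurableX.
have w1 y : circle y -> 0 < cabs2 (1 - w y).
  move=> cy; apply: lt_le_trans (cabs2_kernel_ge _ _ _ r01 cy cz).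
  by rewrite exprn_gt0// subr_gt0.
have u1 y : circle y -> cabs2 (u y) <= 1.
  move=> cy; rewrite /u cabs2M cabs2V cabs2X wE// ler_pdivrMr ?w1// mul1r.
  apply: le_trans (cabs2_kernel_ge _ _ _ r01 cy cz).
  by rewrite -exprM mulnC exprM ler_pXn2r ?nnegrE ?subr_ge0 ?exprn_ge0// ltW.
have fu2 := square_integrableM mu _ _ 1 mu_ u1 f2.
have TrE : Tr mu r f z = \sum_(k < n) real_complex R (r ^+ k) *
    (circle_int mu (fun y => f y * conjc (toC y) ^+ k) * toC z ^+ k) +
    1 * circle_int mu (fun y => f y * u y).
  rewrite /Tr cint_circle_int//; last first.
    by apply: cmeasurableM => //; case: f2.
  have i1 k : integrableC mu (fun y => f y * conjc (toC y) ^+ k).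
    exact/square_integrableC/square_integrable_toC_conjcX.
  pose c k := real_complex R (r ^+ k) * toC z ^+ k.
  have i2 k : integrableC mu (fun y => c k * (f y * conjc (toC y) ^+ k)).
    have i0 := square_integrableC mu _ (square_integrable_cst mu 0).
    by have := integrableC_lin mu (c k) _ _ i0 (i1 k); under eq_fun do rewrite add0r.
  transitivity (circle_int mu (fun y =>
      \sum_(k < n) c k * (f y * conjc (toC y) ^+ k) + 1 * (f y * u y))).
    apply: eq_circle_int => y cy; rewrite -/(w y).
    have w10 : 1 - w y != 0 by rewrite -cabs2_eq0 gt_eqF// w1.
    apply: (mulIf w10); rewrite mulfVK// mul1r mulrDl -mulrA /u mulfVK//.
    have -> : \sum_(k < n) c k * (f y * conjc (toC y) ^+ k) =
        f y * \sum_(k < n) w y ^+ k.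
      rewrite mulr_sumr; apply: eq_bigr => k _.
      by rewrite /c /w !exprMn rmorphXn/=; ring.
    (* After clearing the denominator, the expansion is the finite geometric sum
       [w^n - 1 = (w - 1) * s]. *)
    have := subrX1 (w y) n.
    set s := \sum_(k < n) _ => h.
    have -> : f y * s * (1 - w y) = - f y * ((w y - 1) * s) by ring.
    by rewrite -h; ring.
  rewrite circle_int_lin; last 2 first.
  - exact: (integrableC_sum mu n (fun k y => c k * (f y * conjc (toC y) ^+ k))).
  - exact: square_integrableC.
  congr (_ + _).
  rewrite (circle_int_sum mu n (fun k y => c k * (f y * conjc (toC y) ^+ k)))//.
  by apply: eq_bigr => k _; rewrite circle_intZ// /c; ring.
rewrite TrE mul1r (le_trans (cabs2D_le _ _))// lerD2l ler_pM2l//.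
rewrite (le_trans (cabs2_circle_int_le _ mu_circle _ fu2))//.
by rewrite (le_trans (normsqM_le mu _ _ 1 mu_ u1 f2))// mul1r.
Qed.

(* With [w = conj(xi) z], [1 / (1 - r w) = 1 - conj (1 / (1 - w / r))]. *)
Lemma Tr_inversion f r (z : R * R) : square_integrable mu f -> 1 < r ->
  circle z -> Tr mu r f z =
    circle_int mu f - conjc (Tr mu r^-1 (fun y => conjc (f y)) z).
Proof.
move=> f2 r1 cz; have r0 : 0 < r by exact: lt_trans r1.
have s01 : 0 <= r^-1 < 1 by rewrite invr_ge0 ltW//= invf_lt1.
have s1 : 0 < (1 - r^-1) ^+ 2 by rewrite exprn_gt0// subr_gt0; case/andP: s01.
have cf2 := square_integrable_conjc mu _ f2.
have ms := cmeasurable_kernel r^-1 z.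
have g2 : square_integrable mu (fun y => conjc (f y) /
    (1 - real_complex R r^-1 * conjc (toC y) * toC z)).
  apply: (square_integrableM mu _ _ ((1 - r^-1) ^+ 2)^-1 ms) => // y cy.
  have h := cabs2_kernel_ge _ _ _ s01 cy cz.
  by rewrite cabs2V lef_pV2 ?posrE// (lt_le_trans s1).
rewrite /Tr cint_circle_int//; last first.
  by apply: cmeasurableM; [case: f2|exact: cmeasurable_kernel].
rewrite cint_circle_int//; last by case: g2.
rewrite -circle_int_conjc; last exact: square_integrableC.
rewrite -[X in _ + X]mulN1r -circle_int_lin; last 2 first.
- exact: square_integrableC.
- exact/square_integrableC/square_integrable_conjc.
apply: eq_circle_int => y cy.
set w := conjc (toC y) * toC z.
have ww : w * conjc w = 1.
  by rewrite mulc_conjc cabs2M cabs2_conjc !cabs2_toC// mulr1.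
have rC : real_complex R r * real_complex R r^-1 = 1.
  by rewrite -rmorphM mulfV ?gt_eqF.
have d0 : 1 - real_complex R r^-1 * conjc w != 0.
  rewrite -cabs2_eq0 gt_eqF// (lt_le_trans s1)//.
  apply: le_trans (cabs2_kernel_ge _ _ _ s01 cy cz) _.
  by rewrite -cabs2_conjc conjcD conjcN conjc1 -mulrA conjcM conjc_real.
(* Since [w * conj w = 1], the nonzero [1 - conj w / r] equals [- (conj w / r) * (1 - r w)]. *)
have e0 : 1 - real_complex R r * w != 0.
  apply: contra_neq d0 => h.
  transitivity (- (real_complex R r^-1 * conjc w) * (1 - real_complex R r * w)
    - (real_complex R r * real_complex R r^-1 * (w * conjc w) - 1)); first by ring.
  by rewrite h rC ww; ring.
rewrite conjcM conjcK conjc_inv conjcD conjcN conjc1 -!mulrA -/w.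
rewrite conjcM conjc_real.
set e := 1 - _ in e0 *; set d := 1 - _ in d0 *.
apply: (mulIf e0); apply: (mulIf d0).
have -> : (f y + -1 * (f y / d)) * e * d = (f y * d - f y / d * d) * e by ring.
rewrite !mulfVK//; apply/subr0_eq.
transitivity (f y * (1 - real_complex R r * real_complex R r^-1 * (w * conjc w))).
  by rewrite /d /e; ring.
by rewrite rC ww mul1r subrr mulr0.
Qed.

End CauchyKernel.

(** * Transfer to L^2(mu_alpha) and the uniform bound *)

Section Boundedness.
Context {R : realType} (mu mu_alpha : probability (R * R)%type R).
Variable alpha : R[i].
Hypothesis mu_circle : mu (~` @circle R)%classic = 0%E.
Hypothesis mu_alpha_circle : mu_alpha (~` @circle R)%classic = 0%E.
Hypothesis alpha_circle : cabs2 alpha = 1.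
Hypothesis alpha_neq1 : alpha != 1.
Hypothesis spectral : forall n : nat,
  cint mu_alpha (fun z => toC z ^+ n) = cint mu (iter n (Ualpha mu alpha) (fun=> 1)).

Local Notation A := (Ualpha mu alpha).

Lemma square_integrable_toCX n : square_integrable mu_alpha (fun z => toC z ^+ n).
Proof.
have m := cmeasurableX _ n (@cmeasurable_toC R).
have m1 (x : R * R) : circle x -> cabs2 (toC x ^+ n) <= 1.
  by move=> cx; rewrite cabs2X cabs2_toC// expr1n.
have := square_integrableM mu_alpha _ _ 1 m m1 (square_integrable_cst mu_alpha 1).
by under eq_fun do rewrite mul1r.
Qed.

(** For [k <= j] both sides reduce to the moment of order [j - k], the left by [z * conj z = 1] and
    the right because [A] is isometric. The other case follows by conjugation. *)
Lemma spectral_gram j k :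
  circle_int mu_alpha (fun z => toC z ^+ j * conjc (toC z ^+ k)) =
  circle_int mu (fun x => iter j A (fun=> 1) x * conjc (iter k A (fun=> 1) x)).
Proof.
have one2 := square_integrable_cst mu 1.
have i2 n := square_integrable_iter_Ualpha mu alpha mu_circle n _ one2.
have le_case n m :
    circle_int mu_alpha (fun z => toC z ^+ (m + n) * conjc (toC z ^+ m)) =
    circle_int mu (fun x => iter (m + n) A (fun=> 1) x *
      conjc (iter m A (fun=> 1) x)).
  rewrite iterD iter_Ualpha_isometry//.
  transitivity (circle_int mu_alpha (fun z => toC z ^+ n)).
    apply: eq_circle_int => z cz.
    have h : (toC z * conjc (toC z)) ^+ m = 1 by rewrite toC_conjc// expr1n.
    by rewrite exprD (rmorphXn conjc)/= mulrAC -exprMn h mul1r.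
  transitivity (circle_int mu (iter n A (fun=> 1))).
    rewrite -cint_circle_int//; last by case: (square_integrable_toCX n).
    by rewrite spectral cint_circle_int//; case: (i2 n).
  by apply: eq_circle_int => x _; rewrite conjc1 mulr1.
have [kj|/ltnW jk] := leqP k j.
  by have := le_case (j - k)%N k; rewrite subnKC.
have := congr1 conjc (le_case (k - j)%N j); rewrite subnKC//.
rewrite -!circle_int_conjc; last 2 first.
- by apply: integrableC_mul => //; exact: square_integrable_conjc.
- apply: integrableC_mul; first exact: square_integrable_toCX.
  by apply: square_integrable_conjc; exact: square_integrable_toCX.
have swap (F G : R * R -> R[i]) : (fun x => conjc (F x * conjc (G x))) =
    (fun x => G x * conjc (F x)).
  by apply/funext => x; rewrite conjcM conjcK mulrC.
by rewrite !(swap (fun z => _) (fun z => _)).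
Qed.

Lemma normsq_abel_sum_le f r n : square_integrable mu f -> 0 <= r <= 1 ->
  let P := fun z => \sum_(k < n) real_complex R (r ^+ k) *
    (circle_int mu (fun y => f y * conjc (toC y) ^+ k) * toC z ^+ k) in
  square_integrable mu_alpha P /\
  normsq mu_alpha P <= 4 / cabs2 (alpha - 1) * normsq mu f.
Proof.
move=> f2 r01 /=.
(* A ball whose radius does not depend on [r] or [n]: it is convex, and the partial sums lie in it
   by the Gram identity. *)
pose K g := square_integrable mu_alpha g /\
  normsq mu_alpha g <= 4 / cabs2 (alpha - 1) * normsq mu f.
pose a k := circle_int mu (fun y => f y * conjc (toC y) ^+ k).
have one2 := square_integrable_cst mu 1.
have scale2 c g : square_integrable mu_alpha g ->
    square_integrable mu_alpha (fun z => c * g z).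
  move=> g2; have z2 := square_integrable_cst mu_alpha 0.
  by have := square_integrable_lin mu_alpha c _ _ z2 g2;
    under eq_fun do rewrite add0r.
apply: (abel_sum K r _ (fun k z => a k * toC z ^+ k)) => [g h [g2 gK] [h2 hK]|m].
  have s2 := square_integrable_lin mu_alpha (real_complex R r) _ _
    (scale2 (real_complex R (1 - r)) _ g2) h2.
  split=> //.
  apply: (@le_trans _ _ ((1 - r) * normsq mu_alpha g + r * normsq mu_alpha h)).
    by apply: normsq_le_lin => // x _; exact: cabs2_convex.
  by move: r01 => /andP[r0 r1]; nra.
split.
  apply: (square_integrable_sum mu_alpha m (fun k z => a k * toC z ^+ k)) => k.
  by apply: scale2; exact: square_integrable_toCX.
rewrite (eq_normsq_gram mu_alpha mu (fun k z => toC z ^+ k)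
  (fun k => iter k A (fun=> 1)) a m).
- exact: normsq_partial_sum_le.
- exact: square_integrable_toCX.
- by move=> k; exact: square_integrable_iter_Ualpha.
- exact: spectral_gram.
Qed.

(** The constants serve both ranges of [r]. For [r < 1] the bound is [2 |P|^2 + 2 |f|^2]; for
    [r > 1] inversion gives [2 |f|^2 + 2 (2 |P|^2 + 2 |f|^2)]. *)
Lemma Tr_majorant f r : square_integrable mu f -> 0 <= r -> r != 1 ->
  exists P, [/\ square_integrable mu_alpha P,
    normsq mu_alpha P <= 4 / cabs2 (alpha - 1) * normsq mu f &
    forall z, circle z ->
      cabs2 (Tr mu r f z) <= 4 * cabs2 (P z) + 6 * normsq mu f].
Proof.
have small g s : square_integrable mu g -> 0 <= s < 1 ->
  exists P, [/\ square_integrable mu_alpha P,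
    normsq mu_alpha P <= 4 / cabs2 (alpha - 1) * normsq mu g &
    forall z, circle z ->
      cabs2 (Tr mu s g z) <= 2 * cabs2 (P z) + 2 * normsq mu g].
  move=> g2 /andP[s0 s1].
  (* The number of terms depends on [s], but the bound on the Abel means does not depend on it. *)
  have [n sn] : exists n, s ^+ n <= 1 - s.
    have : `|s| < 1 by rewrite ger0_norm.
    move=> /cvg_expr/cvgr0Pnorm_le/(_ (1 - s)); rewrite subr_gt0 => /(_ s1).
    by move=> [n _ /(_ n (leqnn n))] /(le_trans (ler_norm _)) ?; exists n.
  have s01 : 0 <= s <= 1 by rewrite s0 ltW.
  have [P2 PK] := normsq_abel_sum_le _ _ n g2 s01.
  eexists; split; [exact: P2|exact: PK|] => z cz.
  by apply: Tr_geometric => //; rewrite s0.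
have normsq_ge0 g : 0 <= normsq mu g.
  by apply: Rintegral_ge0 => x _; exact: cabs2_ge0.
move=> f2 r0; rewrite neq_lt => /orP[r1|r1].
  have [|P [P2 PK PT]] := small f r f2; first by rewrite r0.
  exists P; split=> // z /PT /le_trans; apply.
  by have := cabs2_ge0 (P z); have := normsq_ge0 f; lra.
have [||P [P2 PK PT]] := small (fun y => conjc (f y)) r^-1.
- exact: square_integrable_conjc.
- by rewrite invr_ge0 r0 invf_lt1// (lt_trans _ r1).
exists P; rewrite normsq_conjc in PK PT; split=> // z cz.
rewrite Tr_inversion// (le_trans (cabs2D_le _ _))// cabs2N cabs2_conjc.
have := PT z cz; have := cabs2_circle_int_le _ mu_circle _ f2.
by have := cabs2_ge0 (P z); lra.
Qed.

End Boundedness.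

Theorem theorem2p8 (R : realType) (mu mu_alpha : probability (R * R)%type R)
  (alpha : R[i])
  (mu_on_T : mu (~` @circle R)%classic = 0%E)
  (mu_alpha_on_T : mu_alpha (~` @circle R)%classic = 0%E)
  (alpha_in_T : cabs2 alpha = 1) (alpha_ne1 : alpha != 1)
  (mu_alpha_spectral : forall n : int,
     cint mu_alpha (fun z => toC z ^ n) =
     cint mu (Ualpha_pow mu alpha n (fun _ => 1))) :
  exists C : R, forall r : R, 0 <= r -> r != 1 ->
    forall f : R * R -> R[i], cmeasurable f ->
      (\int[mu]_x (cabs2 (f x))%:E < +oo)%E ->
      (\int[mu_alpha]_z (cabs2 (Tr mu r f z))%:E
         <= C%:E * \int[mu]_x (cabs2 (f x))%:E)%E.
Proof.
(* This is the integral of [4 |P|^2 + 6 |f|^2] over a circle of mass 1, with the norm of [P]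
   replaced by its bound. *)
exists (4 * (4 / cabs2 (alpha - 1)) + 6) => r r0 r1 f mf foo.
have f2 := square_integrable_lty mu mu_on_T f mf foo.
have [P [P2 PK PT]] := Tr_majorant mu mu_alpha alpha mu_on_T mu_alpha_on_T
  alpha_in_T alpha_ne1 (fun n => mu_alpha_spectral n) f r f2 r0 r1.
have M2 := square_integrable_cst mu_alpha 1.
(* The factor [|1|^2] presents the constant as a multiple of an integrable function, as
   [integrable_lin] expects. *)
set G := fun z => 4 * cabs2 (P z) + (6 * normsq mu f) * cabs2 (1 : R[i]).
apply: (@le_trans _ _ (\int[mu_alpha]_(z in @circle R) (G z)%:E)%E).
  apply: integral_le_circle => //.
  - by move=> z; exact: cabs2_ge0.
  - apply: measurable_funD => //; apply: measurable_funM => //.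
    by apply: measurable_cabs2; case: P2.
  - by move=> z /PT; rewrite /G cabs2_real expr1n mulr1.
have iG := integrable_lin mu_alpha 4 (6 * normsq mu f) _ _ (proj2 P2) (proj2 M2).
have mcircle := @measurable_circle R.
rewrite -(fineK (integrable_fin_num mcircle iG)).
rewrite -normsq_integral// -EFinM lee_fin -[fine _]/(Rintegral _ _ _).
rewrite Rintegral_lin ?(proj2 P2, proj2 M2)//.
rewrite -!/(normsq _ _) normsq_cst// cabs2_real expr1n mulr1.
by move: PK; lra.
Qed.
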